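(* Let $(X,Y,\langle\cdot,\cdot\rangle)$ be an asymmetric dual pair and let $\alpha$ be a $T_0$ asymmetric locally convex topology on $X$ with $\sigma(X,Y)\subseteq\alpha\subseteq\tau(X,Y)$. Then $(X,\alpha)^*=Y$.
   Context: All vector spaces and cones are over the reals; a cone is a commutative monoid $(Y,+,0)$ with a scalar multiplication by nonnegative reals satisfying the usual vector space axioms. An asymmetric dual pair $(X,Y,\langle\cdot,\cdot\rangle)$ consists of a vector space $X$, a cone $Y$ and a map $\langle\cdot,\cdot\rangle:X\times Y\to\mathbb R$ that is bilinear (with respect to nonnegative scalars in the second variable) and nondegenerate: $\langle x,\cdot\rangle=0$ implies $x=0$, and $\langle\cdot,y\rangle=\langle\cdot,z\rangle$ implies $y=z$. An asymmetric seminorm on a vector space $X$ is a function $p:X\to[0,\infty)$ with $p(rx)=rp(x)$ for $r\ge 0$ and $p(x+y)\le p(x)+p(y)$. A family $\mathcal P$ of asymmetric seminorms on $X$ induces the topology with basis the sets $\{y\in X: p(y-x)<\epsilon\ \forall p\in F\}$, for $x\in X$, $\epsilon>0$, $F\subseteq\mathcal P$ finite. A topology on $X$ arising this way is an asymmetric locally convex topology. The dual space $(X,\alpha)^*$ is the cone of all linear, $\alpha$-upper semicontinuous functions $X\to\mathbb R$. An element $y\in Y$ is identified with the functional $\langle\cdot,y\rangle$, so $(X,\alpha)^*=Y$ means $(X,\alpha)^*=\{\langle\cdot,y\rangle:y\in Y\}$. $\sigma(X,Y)$ is the topology on $X$ induced by the asymmetric seminorms $x\mapsto\max\{\langle x,y\rangle,0\}$,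 $y\in Y$. $\sigma(Y,X)$ is the topology on $Y$ of pointwise convergence on $X$. The Mackey topology $\tau(X,Y)$ is the topology on $X$ induced by the asymmetric seminorms $p_B(x)=\sup_{y\in B}\max\{\langle x,y\rangle,0\}$, where $B$ runs over all convex, $\sigma(Y,X)$-compact subsets of $Y$. *)

(* Defs.v *)
From HB Require Import structures.
From mathcomp Require Import all_boot all_order all_algebra.
From mathcomp Require Import all_classical all_reals all_analysis.
Import Order.TTheory GRing.Theory Num.Theory.
Import numFieldNormedType.Exports.

Set Implicit Arguments.
Unset Strict Implicit.
Unset Printing Implicit Defensive.

Local Open Scope classical_set_scope.
Local Open Scope ring_scope.

(* The nonnegative reals form a commutative semiring. A cone over R is a
   semimodule over it, i.e. an object of [lSemiModType {nonneg R}]. *)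
Section NonnegSemiring.
Context {R : realType}.
Implicit Types a b c : {nonneg R}.

Definition nonneg_zero : {nonneg R} := 0%:nng.
Definition nonneg_one : {nonneg R} := 1%:nng.
Definition nonneg_add a b : {nonneg R} := (a%:num + b%:num)%:nng.
Definition nonneg_mul a b : {nonneg R} := (a%:num * b%:num)%:nng.

Fact nonneg_addA : associative nonneg_add.
Proof. by move=> a b c; apply: val_inj => /=; rewrite addrA. Qed.

Fact nonneg_addC : commutative nonneg_add.
Proof. by move=> a b; apply: val_inj => /=; rewrite addrC. Qed.

Fact nonneg_add0 : left_id nonneg_zero nonneg_add.
Proof. by move=> a; apply: val_inj => /=; rewrite add0r. Qed.

Fact nonneg_mulA : associative nonneg_mul.
Proof. by move=> a b c; apply: val_inj => /=; rewrite mulrA. Qed.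

Fact nonneg_mulC : commutative nonneg_mul.
Proof. by move=> a b; apply: val_inj => /=; rewrite mulrC. Qed.

Fact nonneg_mul1 : left_id nonneg_one nonneg_mul.
Proof. by move=> a; apply: val_inj => /=; rewrite mul1r. Qed.

Fact nonneg_mulDl : left_distributive nonneg_mul nonneg_add.
Proof. by move=> a b c; apply: val_inj => /=; rewrite mulrDl. Qed.

Fact nonneg_mul0 : left_zero nonneg_zero nonneg_mul.
Proof. by move=> a; apply: val_inj => /=; rewrite mul0r. Qed.

HB.instance Definition _ := Choice.on {nonneg R}.
HB.instance Definition _ := GRing.isNmodule.Build {nonneg R}
  nonneg_addA nonneg_addC nonneg_add0.

HB.instance Definition _ := GRing.Nmodule_isComPzSemiRing.Build {nonneg R}
  nonneg_mulA nonneg_mulC nonneg_mul1 nonneg_mulDl nonneg_mul0.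

End NonnegSemiring.

Notation coneType R := (lSemiModType {nonneg R}).

Record asymmetric_dual_pair (R : realType) (X : lmodType R) (Y : coneType R)
    (pairing : X -> Y -> R) : Prop := AsymmetricDualPair {
  pairing_linearl : forall y, scalar (pairing^~ y);
  pairing_addr : forall x y z, pairing x (y + z) = pairing x y + pairing x z;
  pairing_scaler : forall x (a : {nonneg R}) y,
    pairing x (a *: y) = a%:num * pairing x y;
  pairing_nondegl : forall x, (forall y, pairing x y = 0) -> x = 0;
  pairing_nondegr : forall y z,
    (forall x, pairing x y = pairing x z) -> y = z
}.

Section AsymmetricSeminorms.
Context {R : realType} {X : lmodType R}.
Implicit Types (p : X -> R) (P : set (X -> R)).

Record asymmetric_seminorm p : Prop := AsymmetricSeminorm {
  aseminorm_ge0 : forall x, 0 <= p x;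
  aseminormZ : forall r x, 0 <= r -> p (r *: x) = r * p x;
  aseminormD : forall x y, p (x + y) <= p x + p y
}.

Definition seminorm_basis P : set (set X) :=
  [set V | exists (x : X) (e : R) (F : set (X -> R)),
    [/\ 0 < e, finite_set F, F `<=` P &
        V = [set y | forall p, F p -> p (y - x) < e]]].

(* The open sets of the topology induced by P: the unions of basis sets. *)
Definition seminorm_topology P : set (set X) :=
  [set U | exists2 D, D `<=` seminorm_basis P & U = \bigcup_(V in D) V].

End AsymmetricSeminorms.

(* The topology carried by X is not assumed compatible with its linear
   structure: negation is in general not continuous. *)
Section TopologicalDual.
Context {R : realType} (X : preTopologicalLmodType R).

Definition asymmetric_locally_convex : Prop :=
  exists2 P : set (X -> R),
    P `<=` asymmetric_seminorm & (open : set (set X)) = seminorm_topology P.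

Definition upper_semicontinuous (f : X -> R) : Prop :=
  forall a, open [set x | f x < a].

Definition dual_space : set (X -> R) :=
  [set f | scalar f /\ upper_semicontinuous f].

End TopologicalDual.

Arguments dual_space {R} X _.

Section PairTopologies.
Context {R : realType} {X : lmodType R} {Y : coneType R}.
Variable pairing : X -> Y -> R.

(* [sigma(X, Y)] *)
Definition weak_opens : set (set X) :=
  seminorm_topology
    (range (fun (y : Y) (x : X) => Num.max (pairing x y) 0)).

(* Y with [sigma(Y, X)]: the initial topology for the map sending y to
   [pairing^~ y] in the space of functions on X with pointwise convergence. *)
Definition weak_cone : topologicalType :=
  initial_topology ((fun y => pairing^~ y) : Y -> {ptws X -> R}).

Definition cone_convex (B : set Y) : Prop :=
  forall (y z : Y) (s t : {nonneg R}),
    B y -> B z -> s + t = 1 -> B (s *: y + t *: z).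

(* As [sup set0 = 0], the empty B gives the zero seminorm. *)
Definition mackey_seminorm (B : set Y) (x : X) : R :=
  sup [set Num.max (pairing x y) 0 | y in B].

(* [tau(X, Y)] *)
Definition mackey_opens : set (set X) :=
  seminorm_topology [set mackey_seminorm B |
    B in [set B | cone_convex B /\ compact (B : set weak_cone)]].

End PairTopologies.

(* Main.v *)
From HB Require Import structures.
Require Import Defs.
From mathcomp Require Import all_boot all_order all_algebra.
From mathcomp Require Import all_classical all_reals all_analysis.
From mathcomp Require Import ring lra.
Import Order.TTheory GRing.Theory Num.Theory.
Import numFieldNormedType.Exports.
Local Open Scope classical_set_scope.
Local Open Scope ring_scope.

(** The hypothesis sigma(X, Y) `<=` alpha makes every functional [pairing^~ y]
    upper semicontinuous, because the sets [{x | pairing x y < a}] are weakly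
    open.  The content is the converse, which rests on the inclusion of alpha in
    the Mackey topology.

    Let [f] be linear with [{x | f x < 1}] Mackey open.  A neighbourhood of 0 in
    that set is cut out by finitely many seminorms [p_B], and all the sets [B]
    involved fit into one compact convex set [K] containing 0
    ([dominating_compact_convex]); so, for some [d > 0], [k x <= d] for all [k]
    in [K] implies [f x < 1].  By homogeneity, every [x] has a [k] in [K]
    with [d * f x <= k x]: the linear functional [d * f] lies below the support
    function of [K].  Hence [d * f] belongs to [K] ([compact_convex_mem]), so it
    is the pairing with some element of [Y], and then so is [f].

    That a linear functional below the support function of a compact convex [K]
    belongs to [K] is usually deduced from the Hahn-Banach theorem.  Here a
    least squares argument is enough: on finitely many points, the element of
    [K] closest to [f] must agree with [f] ([compact_convex_interpolation]), and
    compactness of [K] for pointwise convergence passes from finitely many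
    points to all of them.

    To have sums, scalings and products of functionals at hand, subsets of [Y]
    are replaced by their images in the space of all functions on [X] with the
    topology of pointwise convergence. *)

(** * Topologies induced by asymmetric seminorms *)

Lemma seminorm_topologyP (R : realType) (X : lmodType R) (P : set (X -> R))
    (U : set X) :
  (forall x, U x -> exists2 V, seminorm_basis P V & V x /\ V `<=` U) ->
  seminorm_topology P U.
Proof.
move=> Unbhs; exists [set V | seminorm_basis P V /\ V `<=` U].
  by move=> V [].
apply/seteqP; split=> [x /Unbhs[V PV [Vx VU]]|x [V [_ VU] /VU//]].
by exists V.
Qed.

Lemma weak_opens_sublevel (R : realType) (X : lmodType R) (Y : coneType R)
    (pairing : X -> Y -> R) (y : Y) (a : R) :
  scalar (pairing^~ y) -> weak_opens pairing [set x | pairing x y < a].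
Proof.
move=> liny; apply: seminorm_topologyP => x /= xa.
have pairingB z : pairing (z - x) y = pairing z y - pairing x y.
  by have := liny (-1) x z; rewrite scaleN1r mulN1r /= ![- _ + _]addrC.
exists [set z | forall p, [set fun x => Num.max (pairing x y) 0] p ->
                  p (z - x) < a - pairing x y].
  exists x, (a - pairing x y), [set fun x => Num.max (pairing x y) 0].
  by split=> //; [rewrite subr_gt0|move=> _ ->; exists y].
split=> [p ->|z /(_ _ erefl)] /=; rewrite pairingB gt_max.
  by rewrite subrr subr_gt0 xa.
by move=> /andP[+ _]; rewrite ltrD2r.
Qed.

(** A basic open set containing 0 may be centred elsewhere.  As its inequalities
    are strict and finite in number, subadditivity lets it be recentred at 0
    with a smaller radius. *)
Lemma seminorm_topology_nbhs0 (R : realType) (X : lmodType R) (P : set (X -> R))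
    (U : set X) :
  (forall p, P p -> forall x y, p (x + y) <= p x + p y) ->
  seminorm_topology P U -> U 0 ->
  exists F (d : R), [/\ finite_set F, F `<=` P, 0 < d &
    forall y, (forall p, F p -> p y <= d) -> U y].
Proof.
move=> Psub [D DP ->] [V DV V0].
have [x [e [F [e0 Ffin FP Vdef]]]] := DP _ DV.
have [m me mP] : exists2 m, m < e & forall p, F p -> p (- x) <= m.
  move: V0; rewrite Vdef /= sub0r; move/finite_seqP: Ffin => [s -> sx].
  exists (\big[Num.max/0]_(p <- s) p (- x)).
    by rewrite big_seq; apply: bigmax_lt => // p; exact: sx.
  by move=> p ps; apply: le_bigmax_seq.
exists F, ((e - m) / 2); split=> //; first by rewrite divr_gt0 // subr_gt0.
move=> y yF; exists V => //; rewrite Vdef /= => p Fp.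
apply: le_lt_trans (Psub _ (FP _ Fp) _ _) _.
have := yF _ Fp; have := mP _ Fp; lra.
Qed.

(** * Compact convex sets of linear functionals *)

Lemma scalar0 (R : realType) (X : lmodType R) (f : X -> R) : scalar f -> f 0 = 0.
Proof. by move=> /(_ (-1) 0 0); rewrite scaler0 addr0 mulN1r addNr. Qed.

Lemma scalarZ (R : realType) (X : lmodType R) (f : X -> R) (a : R) (x : X) :
  scalar f -> f (a *: x) = a * f x.
Proof. by move=> flin; have := flin a x 0; rewrite (scalar0 _ _ _ flin) !addr0. Qed.

Lemma continuous_fst (T U : topologicalType) : continuous (@fst T U).
Proof. by move=> q; exact: cvg_fst. Qed.

Lemma continuous_snd (T U : topologicalType) : continuous (@snd T U).
Proof. by move=> q; exact: cvg_snd. Qed.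

Lemma continuous_sum_sqr (R : realType) (T : topologicalType) (I : Type)
    (s : seq I) (c : I -> R) (g : I -> T -> R) :
  (forall i, continuous (g i)) ->
  continuous (fun t => \sum_(i <- s) (c i - g i t) ^+ 2).
Proof.
move=> gc; apply: continuous_big => [|i _ t]; first exact: add_continuous.
have cg : continuous (fun t => c i - g i t).
  by move=> u; apply: cvgB; [exact: cvg_cst|exact: gc].
exact: (continuous_comp (cg t) (@exprn_continuous R 2 _)).
Qed.

Section FunctionalSets.
Context {R : realType} {X : lmodType R}.
Implicit Types (K L : set {ptws X -> R}) (f : X -> R) (p : X -> R).

Lemma continuous_ptws (T : topologicalType) (g : T -> {ptws X -> R}) :
  (forall x, continuous (fun t => g t x)) -> continuous g.
Proof.
move=> gc t; apply/cvg_sup => x; move: t.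
apply/(@continuousP _ (initial_topology (fun f : X -> R => f x))) => _ [A oA <-].
by have /continuousP/(_ A oA) := gc x.
Qed.

Lemma continuous_ptws_eval (x : X) : continuous (fun k : {ptws X -> R} => k x).
Proof. exact: (@proj_continuous X (fun=> R) x). Qed.

Definition functional_convex K := forall k l (s t : R),
  0 <= s -> 0 <= t -> s + t = 1 -> K k -> K l ->
  K (fun x => s * k x + t * l x).

(** Let [k] minimise over [K] the sum of the squares [(f x - k x) ^+ 2] for [x]
    in [xs].  Minimality along the segments issued from [k] says that the
    combination [u] of the points of [xs] with coefficients [f x - k x] satisfies
    [l u <= k u] for all [l] in [K].  Since some such [l] has [f u <= l u], it
    follows that [f u <= k u]; but [f u - k u] is the minimum itself, so the
    minimum is 0. *)
Lemma compact_convex_interpolation K f (xs : seq X) :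
  compact K -> functional_convex K -> (forall k, K k -> scalar k) -> scalar f ->
  (forall x, exists2 k, K k & f x <= k x) ->
  exists2 k, K k & {in xs, forall x, k x = f x}.
Proof.
move=> Kcompact Kconvex Klin flin fK.
pose dist (k : {ptws X -> R}) := \sum_(x <- xs) (f x - k x) ^+ 2.
have dist_cont : continuous dist.
  exact: (@continuous_sum_sqr R {ptws X -> R} X xs f (fun x k => k x)
    continuous_ptws_eval).
have [k0 Kk0 _] := fK 0.
have Kn0 : K !=set0 by exists k0.
have [k /set_mem Kk kmin] :=
  compact_EVT_min Kn0 Kcompact (continuous_subspaceT dist_cont).
pose u := \sum_(x <- xs) (f x - k x) *: x.
have linE (g : X -> R) : scalar g -> g u = \sum_(x <- xs) (f x - k x) * g x.
  move=> glin; rewrite /u; elim: xs {dist dist_cont kmin u} => [|x s IH].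
    by rewrite !big_nil scalar0.
  by rewrite !big_cons glin IH.
have [l Kl ful] := fK u.
have lku : l u <= k u.
  rewrite leNgt; apply/negP => kul.
  (* If [0 < c], moving from [k] towards [l] by [t] changes the sum of squares by
     [t ^+ 2 * D - 2 * t * c], which is negative when [t * D < 2 * c]; the
     chosen [t] satisfies this, as well as [t <= 1], even if [D = 0]. *)
  pose c := l u - k u; pose D := \sum_(x <- xs) (l x - k x) ^+ 2.
  have c0 : 0 < c by rewrite subr_gt0.
  have D0 : 0 <= D by apply: sumr_ge0 => x _; exact: sqr_ge0.
  pose t := c / (c + D).
  have cD : 0 < c + D by rewrite ltr_wpDr.
  have t0 : 0 < t by rewrite divr_gt0.
  have t1 : t <= 1 by rewrite ler_pdivrMr // mul1r lerDl.
  have tD : t * D < c * 2.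
    rewrite /t mulrAC ltr_pdivrMr //; nra.
  have Kseg : K (fun x => (1 - t) * k x + t * l x).
    by apply: Kconvex => //; [rewrite subr_ge0|exact: ltW|rewrite subrK].
  have := kmin _ (mem_set Kseg).
  apply/negP; rewrite -ltNge -subr_gt0.
  suff -> : dist k - dist (fun x => (1 - t) * k x + t * l x) =
      t * (c * 2 - t * D) by rewrite mulr_gt0 // subr_gt0.
  have -> : c = \sum_(x <- xs) (f x - k x) * (l x - k x).
    rewrite /c (linE l) ?(linE k); [|exact: Klin..].
    by rewrite -sumrB; apply: eq_bigr => x _; ring.
  rewrite /D /dist mulr_suml mulr_sumr -!sumrB mulr_sumr.
  by apply: eq_bigr => x _; ring.
exists k => // x xxs; apply/eqP; rewrite eq_sym -subr_eq0 -sqrf_eq0.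
have : dist k <= 0.
  suff -> : dist k = f u - k u by rewrite subr_le0 (le_trans ful).
  rewrite (linE f) // (linE k); last exact: Klin.
  by rewrite -sumrB; apply: eq_bigr => z _; ring.
rewrite le_eqVlt ltNge sumr_ge0 ?orbF; last by move=> *; exact: sqr_ge0.
rewrite psumr_eq0 => [/allP/(_ _ xxs)//|*]; exact: sqr_ge0.
Qed.

(** By [compact_convex_interpolation], the closed sets [{k in K | k x = f x}]
    have the finite intersection property. *)
Lemma compact_convex_mem K f :
  compact K -> functional_convex K -> (forall k, K k -> scalar k) -> scalar f ->
  (forall x, exists2 k, K k & f x <= k x) -> K f.
Proof.
move=> Kcompact Kconvex Klin flin fK.
(* [compact_In0] is about pointed spaces; 0 serves as the point. *)
pose T : ptopologicalType :=
  HB.pack {ptws X -> R} (isPointed.Build {ptws X -> R} (fun=> 0)).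
have := Kcompact; rewrite -[compact K]/(compact (K : set T)) compact_In0 => Kfip.
have [||k kP] := Kfip X setT (fun x => K `&` [set k | k x = f x]).
- exists (fun x => [set k : {ptws X -> R} | k x = f x]) => // x _.
  apply: (@preimage_closed _ _ (fun k : {ptws X -> R} => k x) [set f x]).
    by move=> k _; exact: continuous_ptws_eval.
  exact: closed_eq.
- move=> xs _.
  have [k Kk kf] := compact_convex_interpolation _ _ (finmap.enum_fset xs)
    Kcompact Kconvex Klin flin fK.
  by exists k => x /= /kf.
have Kk : K k by have [] := kP 0 I.
suff -> : f = k by [].
by apply/funext => x; have [_] := kP x I.
Qed.

(** [p] is at most the support function of the union of [K] and [{0}].  The
    formulation by upper bounds avoids suprema, hence any boundedness or
    nonemptiness condition on [K]. *)
Definition dominates K p := forall x e,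
  0 <= e -> (forall k, K k -> k x <= e) -> p x <= e.

Lemma dominatesS K L p : K `<=` L -> dominates K p -> dominates L p.
Proof. by move=> KL Kp x e e0 Lx; apply: Kp => // k /KL; exact: Lx. Qed.

(** This is the Minkowski sum of [K] and of the union of the segments from 0 to
    the points of [L].  When [K] contains 0 and [L] is not empty, it contains
    both [K] and [L]. *)
Definition cone_join K L : set {ptws X -> R} :=
  [set (fun x => q.1 x + q.2.1 * q.2.2 x) |
    q in K `*` (`[0, 1] `*` L)].

(** It is a continuous image of the product of [K], the unit interval and
    [L]. *)
Lemma compact_cone_join K L : compact K -> compact L -> compact (cone_join K L).
Proof.
move=> Kc Lc; apply: continuous_compact; last first.
  by apply: compact_setX => //; apply: compact_setX => //; exact: segment_compact.
apply: continuous_subspaceT; apply: continuous_ptws => x q.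
have kc : continuous (fun q : {ptws X -> R} * (R * {ptws X -> R}) => q.1 x).
  move=> r; apply: (@continuous_comp _ _ _ fst (fun k : {ptws X -> R} => k x)).
    exact: continuous_fst.
  exact: continuous_ptws_eval.
have tc : continuous (fun q : {ptws X -> R} * (R * {ptws X -> R}) => q.2.1).
  move=> r; apply: (@continuous_comp _ _ _ snd fst).
    exact: continuous_snd.
  exact: continuous_fst.
have lc : continuous (fun q : {ptws X -> R} * (R * {ptws X -> R}) => q.2.2 x).
  move=> r.
  apply: (@continuous_comp _ _ _ (snd \o snd) (fun k : {ptws X -> R} => k x)).
    by apply: (@continuous_comp _ _ _ snd snd); exact: continuous_snd.
  exact: continuous_ptws_eval.
exact: (continuousD (kc q) (continuousM (tc q) (lc q))).
Qed.

(** A convex combination of [k + a * l] and [k' + a' * l'] has its second part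
    equal to [b] times a convex combination of [l] and [l'], with
    [b = s * a + t * a']. *)
Lemma convex_cone_join K L :
  functional_convex K -> functional_convex L -> functional_convex (cone_join K L).
Proof.
move=> Kconvex Lconvex _ _ s t s0 t0 st
  [[k [a l]] [Kk [/= + Ll]] <-] [[k' [a' l']] [Kk' [/= + Ll']] <-].
rewrite /= !in_itv /= => /andP[a0 a1] /andP[a'0 a'1].
have sa0 : 0 <= s * a by rewrite mulr_ge0.
have ta0 : 0 <= t * a' by rewrite mulr_ge0.
pose b := s * a + t * a'.
have b0 : 0 <= b by rewrite addr_ge0.
have b1 : b <= 1 by rewrite /b; nra.
have Kkk := Kconvex _ _ _ _ s0 t0 st Kk Kk'.
have [bE|bneq0] := eqVneq b 0.
  exists (fun x => s * k x + t * k' x, (0, l)).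
    by split=> //=; split=> //=; rewrite in_itv /= lexx ler01.
  move: (bE) => /eqP; rewrite paddr_eq0 // => /andP[/eqP sa /eqP ta].
  apply/funext => x /=; rewrite !mulrDr !mulrA sa ta; ring.
have bgt0 : 0 < b by rewrite lt_neqAle eq_sym bneq0.
have Lll : L (fun x => s * a / b * l x + t * a' / b * l' x).
  apply: Lconvex => //; rewrite ?divr_ge0 //.
  by rewrite -mulrDl divff.
exists (fun x => s * k x + t * k' x,
        (b, fun x => s * a / b * l x + t * a' / b * l' x)).
  by split=> //=; split=> //=; rewrite in_itv /= b0.
by apply/funext => x /=; field.
Qed.

(** Starting from [{0}], the sets attached to the elements of [F] are absorbed
    one after the other by [cone_join], which stays inside the convex cone
    [S]. *)
Lemma dominating_compact_convex (S : set {ptws X -> R}) (F : set (X -> R)) :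
  S (fun=> 0) ->
  (forall k l (t : R), S k -> S l -> 0 <= t -> S (fun x => k x + t * l x)) ->
  finite_set F ->
  (forall p, F p -> exists L : set {ptws X -> R},
    [/\ compact L, functional_convex L, L `<=` S & dominates L p]) ->
  exists K : set {ptws X -> R},
    [/\ compact K, functional_convex K, K `<=` S, K (fun=> 0) &
        forall p, F p -> dominates K p].
Proof.
move=> S0 SD /finite_seqP[s ->]; elim: s => [|p s IH] FL.
  exists [set fun=> 0]; split=> //; first exact: compact_set1.
    move=> _ _ a b _ _ _ -> ->; rewrite /= !mulr0 addr0; reflexivity.
  by move=> _ ->.
have [q qs|K [Kc Kconvex KS K0 Kdom]] := IH.
  by apply: FL; rewrite /= in_cons qs orbT.
have [|L [Lc Lconvex LS Ldom]] := FL p; first by rewrite /= mem_head.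
(* [cone_join K L] is empty when [L] is, but then [p <= 0]. *)
have [L0|/set0P[l Ll]] := eqVneq L set0.
  exists K; split=> // q; rewrite /= in_cons => /orP[/eqP->|/Kdom//].
  by move=> x e e0 _; apply: Ldom => // k; rewrite L0.
exists (cone_join K L); split.
- exact: compact_cone_join.
- exact: convex_cone_join.
- move=> _ [[k [t l']] [Kk [/= + Ll']] <-]; rewrite in_itv /= => /andP[t0 _].
  by apply: SD => //; [exact: KS|exact: LS].
- exists (fun=> 0, (0, l)); last by apply/funext => x /=; rewrite mul0r addr0.
  by split=> //=; split=> //=; rewrite in_itv /= lexx ler01.
- move=> q; rewrite /= in_cons => /orP[/eqP->|/Kdom].
    apply: dominatesS Ldom => k Lk; exists (fun=> 0, (1, k)).
      by split=> //=; split=> //=; rewrite in_itv /= lexx ler01.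
    by apply/funext => x /=; rewrite add0r mul1r.
  apply: dominatesS => k Kk; exists (k, (0, l)).
    by split=> //=; split=> //=; rewrite in_itv /= lexx ler01.
  by apply/funext => x /=; rewrite mul0r addr0.
Qed.

End FunctionalSets.

(** * The dual of the Mackey topology *)

Section DualPair.
Context {R : realType} {X : lmodType R} {Y : coneType R}.
Variable pairing : X -> Y -> R.
Hypothesis hpair : asymmetric_dual_pair pairing.

Definition functional (y : Y) : {ptws X -> R} := pairing^~ y.

Lemma compact_functional (B : set Y) :
  compact (B : set (weak_cone pairing)) -> compact (functional @` B).
Proof.
move=> Bc; apply: (@continuous_compact (weak_cone pairing)) => //.
by apply: continuous_subspaceT; exact: initial_continuous.
Qed.

Lemma convex_functional (B : set Y) :
  cone_convex B -> functional_convex (functional @` B).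
Proof.
move=> Bconvex _ _ s t s0 t0 st [y By <-] [z Bz <-].
exists (NngNum s0 *: y + NngNum t0 *: z); last first.
  apply/funext => x.
  by rewrite /functional (pairing_addr hpair) !(pairing_scaler hpair).
by apply: Bconvex => //; apply: val_inj.
Qed.

Lemma functional_scalar (y : Y) : scalar (functional y).
Proof. exact: pairing_linearl. Qed.

Lemma functionalD (y z : Y) (t : R) (t0 : 0 <= t) :
  functional (y + NngNum t0 *: z) = fun x => functional y x + t * functional z x.
Proof.
by apply/funext => x; rewrite /functional (pairing_addr hpair) (pairing_scaler hpair).
Qed.

Lemma functional0 : functional 0 = fun=> 0.
Proof.
apply/funext => x; have /eqP := pairing_addr hpair x 0 0.
by rewrite addr0 -subr_eq0 opprD addNKr oppr_eq0 => /eqP.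
Qed.

(** Without this bound the supremum defining the seminorm would be a default
    value. *)
Lemma mackey_seminorm_ub (B : set Y) x :
  compact (B : set (weak_cone pairing)) ->
  has_ubound [set Num.max (pairing x y) 0 | y in B].
Proof.
move=> /compact_functional Bc.
have [B0|/set0P B0] := eqVneq (functional @` B) set0.
  exists 0 => _ [y By <-].
  have : (functional @` B) (functional y) by exists y.
  by rewrite B0.
have [k _ kmax] := compact_EVT_max B0 Bc
  (continuous_subspaceT (continuous_ptws_eval x)).
exists (Num.max (k x) 0) => _ [y By <-].
rewrite ge_max !le_max lexx orbT andbT; apply/orP; left.
by apply: (kmax (functional y)); rewrite inE; exists y.
Qed.

Lemma mackey_seminormD (B : set Y) x z :
  compact (B : set (weak_cone pairing)) ->
  mackey_seminorm pairing B (x + z) <=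
  mackey_seminorm pairing B x + mackey_seminorm pairing B z.
Proof.
move=> Bc; have [->|/set0P[y0 By0]] := eqVneq B set0.
  by rewrite /mackey_seminorm !image_set0 sup0 addr0.
apply: ge_sup; first by exists (Num.max (pairing (x + z) y0) 0), y0.
move=> _ [y By <-].
have ub w : Num.max (pairing w y) 0 <= mackey_seminorm pairing B w.
  by apply: ub_le_sup; [exact: mackey_seminorm_ub|exists y].
have := ub x; have := ub z; rewrite !ge_max => /andP[zy z0] /andP[xy x0].
have := pairing_linearl hpair y 1 x z; rewrite /= scale1r mul1r => ->.
by rewrite lerD // addr_ge0.
Qed.

Lemma dominates_mackey_seminorm (B : set Y) :
  dominates (functional @` B) (mackey_seminorm pairing B).
Proof.
move=> x e e0 Be; have [->|/set0P[y0 By0]] := eqVneq B set0.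
  by rewrite /mackey_seminorm image_set0 sup0.
apply: ge_sup; first by exists (Num.max (pairing x y0) 0), y0.
by move=> _ [y By <-]; rewrite ge_max e0 andbT; apply: (Be (functional y)); exists y.
Qed.

Lemma mackey_continuous_functional (f : X -> R) :
  scalar f -> mackey_opens pairing [set x | f x < 1] ->
  exists y, f = functional y.
Proof.
move=> flin /seminorm_topology_nbhs0[].
- by move=> _ [B [_ Bc] <-] x z; exact: mackey_seminormD.
- by rewrite /= scalar0.
move=> F [d [Ffin FP d0 Fd]].
have [|k l t [y _ <-] [z _ <-] t0|//|p /FP[B [Bconvex Bc] <-]|] :=
  dominating_compact_convex (range functional) F.
- by exists 0 => //; exact: functional0.
- by exists (y + NngNum t0 *: z) => //; exact: functionalD.
- exists (functional @` B); split.
  + exact: compact_functional.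
  + exact: convex_functional.
  + by move=> _ [y _ <-]; exists y.
  + exact: dominates_mackey_seminorm.
move=> K [Kc Kconvex KS K0 Kdom].
have Klin k : K k -> scalar k by move=> /KS[y _ <-]; exact: functional_scalar.
have /KS[y _ yE] : K (fun x => d * f x).
  apply: compact_convex_mem => //.
    by move=> a x z; rewrite flin mulrDr mulrCA.
  move=> x; have [fx0|fx0] := leP (f x) 0.
    by exists (fun=> 0) => //; rewrite pmulr_rle0.
  (* If every [k x] were less than [d * f x], then all [k] in [K] would be at
     most [d] at the point [(f x)^-1 *: x], where [f] takes the value 1. *)
  apply: contrapT => nK.
  suff : f ((f x)^-1 *: x) < 1 by rewrite scalarZ // mulVf ?ltxx // gt_eqF.
  apply: Fd => p Fp; apply: Kdom => //; first exact: ltW.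
  move=> k Kk; rewrite scalarZ; last exact: Klin.
  rewrite mulrC ler_pdivrMr // leNgt; apply/negP => dk.
  by apply: nK; exists k => //; exact: ltW.
have d'0 : 0 <= d^-1 by rewrite invr_ge0 ltW.
exists (NngNum d'0 *: y); apply/funext => x.
rewrite /functional (pairing_scaler hpair) /=.
have -> : pairing x y = d * f x by rewrite -[RHS]/((fun x => d * f x) x) -yE.
by rewrite mulKf // gt_eqF.
Qed.

End DualPair.

Theorem corollary3p13 (R : realType) (X : preTopologicalLmodType R)
    (Y : coneType R) (pairing : X -> Y -> R)
    (hpair : asymmetric_dual_pair pairing)
    (alpha_lc : asymmetric_locally_convex X)
    (alpha_T0 : kolmogorov_space X)
    (sigma_sub_alpha : weak_opens pairing `<=` (open : set (set X)))
    (alpha_sub_tau : (open : set (set X)) `<=` mackey_opens pairing) :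
  dual_space X = range (fun (y : Y) (x : X) => pairing x y).
Proof.
apply/seteqP; split=> [f [flin fusc]|_ [y _ <-]].
  have [y ->] := mackey_continuous_functional _ hpair _ flin
    (alpha_sub_tau _ (fusc 1)).
  by exists y.
have liny := pairing_linearl hpair y.
by split=> // a; apply: sigma_sub_alpha; exact: weak_opens_sublevel.
Qed.
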